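(* Let $S$ be a finite generating set of $\mathbb{Z}^n$ and let $\Gamma=\mathrm{Cay}(\mathbb{Z}^n;S)$. Then $\Gamma$ is a normal Cayley (di)graph of $\mathbb{Z}^n$; that is, the group of translations $\{x\mapsto x+c : c\in\mathbb{Z}^n\}\cong\mathbb{Z}^n$ is a normal subgroup of $\mathrm{Aut}(\Gamma)$.
   Context: For a subset $S\subseteq\mathbb{Z}^n\setminus\{0\}$, the Cayley digraph $\mathrm{Cay}(\mathbb{Z}^n;S)$ has vertex set $\mathbb{Z}^n$ and an arc from $x$ to $x+s$ for all $x\in\mathbb{Z}^n$, $s\in S$ (regarded as an undirected graph if $S=-S$). $\mathrm{Aut}(\Gamma)$ is the group of (di)graph automorphisms of $\Gamma$. ''Generating'' means generating as a group. *)

(* Defs.v *)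
From HB Require Import structures.
From mathcomp Require Import all_boot all_order all_algebra.
From mathcomp Require Import boolp classical_sets functions cardinality.

Set Implicit Arguments.
Unset Strict Implicit.
Unset Printing Implicit Defensive.

Import GRing.Theory.
Local Open Scope ring_scope.
Local Open Scope classical_set_scope.

Record digraph := Digraph {
  vertex :> Type;
  arc : vertex -> vertex -> Prop
}.

Section Aut.
Variable Gamma : digraph.

(* The inverse map is part of the data, which avoids a use of choice; it is
   determined by [aut_fun], see [aut_ext]. *)
Record Aut := MkAut {
  aut_fun :> Gamma -> Gamma;
  aut_inv : Gamma -> Gamma;
  aut_funK : cancel aut_fun aut_inv;
  aut_invK : cancel aut_inv aut_fun;
  aut_arc : forall x y, arc (aut_fun x) (aut_fun y) <-> arc x y
}.

Lemma aut_ext (g h : Aut) : g =1 h -> g = h.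
Proof.
case: g h => [f f' fK f'K fa] [k k' kK k'K ka] /= fk.
have e : f = k by apply/funext.
have e' : f' = k'.
  by apply/funext => x; rewrite -[in LHS](k'K x) -fk fK.
by subst f' k; congr MkAut; exact: Prop_irrelevance.
Qed.

Definition aut_one : Aut :=
  @MkAut id id (fun=> erefl) (fun=> erefl) (fun x y => iff_refl _).

Lemma aut_inv_arc (g : Aut) x y : arc (aut_inv g x) (aut_inv g y) <-> arc x y.
Proof. by rewrite -(aut_arc g) !aut_invK. Qed.

Definition aut_V (g : Aut) : Aut :=
  MkAut (@aut_invK g) (@aut_funK g) (aut_inv_arc g).

Lemma aut_comp_arc (g h : Aut) x y : arc ((g \o h) x) ((g \o h) y) <-> arc x y.
Proof. by rewrite /= !aut_arc. Qed.

Definition aut_comp (g h : Aut) : Aut :=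
  MkAut (can_comp (@aut_funK g) (@aut_funK h))
        (can_comp (@aut_invK h) (@aut_invK g)) (aut_comp_arc g h).

Lemma aut_compA : associative aut_comp.
Proof. by move=> f g h; apply: aut_ext. Qed.

Lemma aut_comp1l : left_id aut_one aut_comp.
Proof. by move=> f; apply: aut_ext. Qed.

Lemma aut_comp1r : right_id aut_one aut_comp.
Proof. by move=> f; apply: aut_ext. Qed.

Lemma aut_compVl : left_inverse aut_one aut_V aut_comp.
Proof. by move=> f; apply: aut_ext => x /=; rewrite aut_funK. Qed.

Lemma aut_compVr : right_inverse aut_one aut_V aut_comp.
Proof. by move=> f; apply: aut_ext => x /=; rewrite aut_invK. Qed.

HB.instance Definition _ := gen_eqMixin Aut.
HB.instance Definition _ := gen_choiceMixin Aut.
HB.instance Definition _ := isGroup.Build Aut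
  aut_compA aut_comp1l aut_comp1r aut_compVl aut_compVr.

End Aut.

Definition normal_subgroup (G : groupType) (N : set G) : Prop :=
  group_closed [in N] /\ forall g h : G, N g -> N (g ^ h)%g.

Section Cayley.
Variable V : zmodType.

Definition generates (S : set V) : Prop :=
  smallest (fun H : set V => zmod_closed [in H]) S = setT.

Definition Cay (S : set V) : digraph :=
  @Digraph V (fun x y => exists2 s, S s & y = x + s).

Variable S : set V.

Lemma translation_arc (c x y : V) :
  @arc (Cay S) (x + c) (y + c) <-> @arc (Cay S) x y.
Proof.
split=> -[s Ss e]; exists s => //.
  by apply: (addIr c); rewrite e addrAC.
by rewrite e addrAC.
Qed.

Definition translation (c : V) : Aut (Cay S) :=
  @MkAut (Cay S) (fun x : V => x + c) (fun x : V => x - c)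
    (addrK c) (subrK c) (translation_arc c).

Definition translations : set (Aut (Cay S)) := range translation.

End Cayley.

Arguments translation {V} S c.
Arguments translations {V} S.

(* Main.v *)
Require Import Defs.
From HB Require Import structures.
From mathcomp Require Import all_boot all_order all_algebra.
From mathcomp Require Import boolp classical_sets functions cardinality.
From mathcomp Require Import zify.

Set Implicit Arguments.
Unset Strict Implicit.
Unset Printing Implicit Defensive.

Import Order.TTheory GRing.Theory Num.Theory.
Local Open Scope ring_scope.
Local Open Scope classical_set_scope.

(** Every automorphism [phi] of the digraph is an affine map of Z^n, and an
    affine bijection conjugates translations to translations.

    Call [t] in a finite set [T] extremal when [t + t] is a sum of two elements
    of [T] only as [t + t] (for instance when [t] is a vertex of the convex hull
    of [T]).  A lexicographically maximal element is extremal, so a nonempty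
    [T] has an extremal element ([exists_extremal]).  Extremality of the step
    from [x] to [y] can be read off the digraph: it says that [y] is the only
    midpoint of the walks of length two from [x] to some [z] ([extremalP]), and
    then automatically [z - y = y - x].  So an automorphism of Cay(T) sends
    extremal arcs to extremal arcs, and sends each line in an extremal direction
    [t] to a line, with evenly spaced points ([extremal_line]).

    The images of two such parallel lines are parallel: if the base points differ
    by a generator [s], then corresponding points on the images differ by elements
    of the finite set [S], which is impossible for lines with different directions
    in a torsion-free group ([extremal_parallel]).  As [S] generates,
    [phi (x + t) - phi x] does not depend on [x].

    Finally, deleting the extremal elements from [S] leaves a smaller set whose
    arcs [phi] still preserves, so the argument can be repeated until it has
    reached every element of [S] ([preserved_rigid]).  The remaining sets may
    generate smaller and smaller subgroups, so the comparison of parallel lines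
    always uses the original [S]. *)

(** * Extremal steps *)

(** For a bijection [phi] this says that [phi] is an automorphism of Cay(T). *)
Definition preserves_steps (V : zmodType) (phi : V -> V) (T : seq V) : Prop :=
  forall x y, (phi y - phi x \in T) = (y - x \in T).

Definition extremal (V : zmodType) (T : seq V) (t : V) : bool :=
  (t \in T) && all (fun a => all (fun b => (a + b == t + t) ==> (a == t)) T) T.

Definition unique_midpoint (V : zmodType) (T : seq V) (x y z : V) : Prop :=
  [/\ y - x \in T, z - y \in T
    & forall w, w - x \in T -> z - w \in T -> w = y].

Lemma extremal_mem_eq (V : zmodType) (T : seq V) (t : V) :
  extremal T t ->
  forall a b, a \in T -> b \in T -> a + b = t + t -> a = t.
Proof.
case/andP=> _ /allP ext a b aT bT eab.
by move/allP: (ext a aT) => /(_ b bT); rewrite eab eqxx => /eqP.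
Qed.

(** Exchanging the two steps of a walk of length two gives a walk with the same
    ends, so uniqueness of the midpoint forces the steps to be equal. *)
Lemma unique_midpoint_straight (V : zmodType) (T : seq V) (x y z : V) :
  unique_midpoint T x y z -> z - y = y - x.
Proof.
case=> xyT yzT uniq_y; rewrite -[in RHS](uniq_y (x + (z - y))).
- by rewrite addrAC subrr add0r.
- by rewrite addrAC subrr add0r.
by rewrite (_ : z - _ = y - x) // opprD opprB addrCA [z + _]addrCA subrr addr0 addrC.
Qed.

Lemma extremal_unique_midpoint (V : zmodType) (T : seq V) (x t : V) :
  extremal T t -> unique_midpoint T x (x + t) (x + t + t).
Proof.
move=> ext; have /andP[tT _] := ext.
split=> [||w xwT wzT]; first by rewrite addrAC subrr add0r.
  by rewrite addrAC subrr add0r.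
rewrite -(extremal_mem_eq ext xwT wzT) 1?[RHS]addrC ?subrK //.
by rewrite addrC subrKA addrAC [x + t - x]addrAC subrr add0r.
Qed.

(** The right-hand side mentions only the arcs of Cay(T); this is what makes
    extremality invariant under automorphisms. *)
Lemma extremalP (V : zmodType) (T : seq V) (x y : V) :
  extremal T (y - x) <-> exists z, unique_midpoint T x y z.
Proof.
split=> [ext | [z mid]].
  exists (y + (y - x)); have := extremal_unique_midpoint x ext.
  by rewrite [x + _]addrC subrK.
have ezy := unique_midpoint_straight mid; case: mid => xyT _ uniq_y.
apply/andP; split=> //; apply/allP => a aT; apply/allP => b bT.
apply/implyP => /eqP eab; apply/eqP; rewrite -(uniq_y (x + a)).
- by rewrite addrAC subrr add0r.
- by rewrite addrAC subrr add0r.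
suff -> : z - (x + a) = b by [].
have -> : b = y - x + (y - x) - a by rewrite -eab addrAC subrr add0r.
by rewrite -{1}ezy opprD addrA [z - y + _]addrA subrK.
Qed.

(** * Extremal elements exist *)

Lemma exists_argmax (V : eqType) (f : V -> int) (T : seq V) :
  T != [::] -> exists2 t, t \in T & {in T, forall a, (f a <= f t)%R}.
Proof.
elim: T => // a [_ _ | b T IH _].
  by exists a; rewrite ?mem_head // => b; rewrite inE => /eqP ->.
have [//|t tT max_t] := IH.
have [le_at|lt_ta] := leP (f a) (f t).
  exists t; first by rewrite inE tT orbT.
  by move=> c; rewrite inE => /orP[/eqP-> // | /max_t].
exists a; first exact: mem_head.
move=> c; rewrite inE => /orP[/eqP-> // | /max_t le_ct].
exact: le_trans le_ct (ltW lt_ta).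
Qed.

(** Lexicographic maximisation: keep the maximisers of the first function and
    recurse among them.  If [a + b = t + t] where [t] maximises an additive
    [f i], then [f i a = f i b = f i t], so [a] and [b] survive the selection. *)
Lemma exists_lex_extremal (V : zmodType) (I : eqType) (f : I -> V -> int)
    (fD : forall i, {morph f i : a b / a + b}) (r : seq I) (T : seq V) :
  T != [::] ->
  exists2 t, t \in T & forall a b, a \in T -> b \in T -> a + b = t + t ->
    {in r, forall i, f i a = f i t}.
Proof.
elim: r T => [|i r IH] T T0.
  by case: T T0 => // t T _; exists t; rewrite ?mem_head.
have [m mT max_m] := exists_argmax (f i) T0.
have [|t] := IH [seq a <- T | f i a == f i m].
  by rewrite -has_filter; apply/hasP; exists m.
rewrite mem_filter => /andP[/eqP ft tT] ext_t; exists t => // a b aT bT eab.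
have fab : f i a + f i b = f i m + f i m by rewrite -fD eab fD ft.
have fa : f i a = f i m by have := max_m a aT; have := max_m b bT; lia.
have fb : f i b = f i m by have := max_m a aT; have := max_m b bT; lia.
move=> j; rewrite inE => /orP[/eqP-> | jr]; first by rewrite fa ft.
by apply: (ext_t a b) jr; rewrite // mem_filter ?fa ?fb eqxx.
Qed.

Lemma exists_extremal (n : nat) (T : seq 'rV[int]_n) :
  T != [::] -> has (extremal T) T.
Proof.
move=> T0.
have coordD (i : 'I_n) : {morph (fun v : 'rV[int]_n => v 0 i) : a b / a + b}.
  by move=> a b; rewrite mxE.
have [t tT ext_t] := exists_lex_extremal coordD (enum 'I_n) T0.
apply/hasP; exists t => //; rewrite /extremal tT /=.
apply/allP => a aT; apply/allP => b bT; apply/implyP => /eqP eab.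
by apply/eqP/rowP => i; apply: (ext_t a b); rewrite ?mem_enum.
Qed.

(** * Automorphisms and extremal steps *)

Lemma preserves_steps_can (V : zmodType) (phi psi : V -> V) (T : seq V) :
  cancel psi phi -> preserves_steps phi T -> preserves_steps psi T.
Proof. by move=> psiK pres x y; rewrite -pres !psiK. Qed.

Lemma unique_midpoint_preserved (V : zmodType) (phi psi : V -> V) (T : seq V)
    (x y z : V) :
  cancel phi psi -> cancel psi phi -> preserves_steps phi T ->
  unique_midpoint T x y z -> unique_midpoint T (phi x) (phi y) (phi z).
Proof.
move=> phiK psiK pres [xyT yzT uniq_y]; split; rewrite ?pres // => w xwT wzT.
by rewrite -[w]psiK (uniq_y (psi w)) // -pres psiK.
Qed.

Lemma extremal_preserved (V : zmodType) (phi psi : V -> V) (T : seq V) :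
  cancel phi psi -> cancel psi phi -> preserves_steps phi T ->
  forall x y, extremal T (phi y - phi x) = extremal T (y - x).
Proof.
move=> phiK psiK pres x y; apply/idP/idP => /extremalP[z mid].
  apply/extremalP; exists (psi z); rewrite -[x]phiK -[y]phiK.
  apply: (unique_midpoint_preserved psiK phiK) mid.
  exact: preserves_steps_can pres.
apply/extremalP; exists (phi z).
exact: (unique_midpoint_preserved phiK psiK).
Qed.

Lemma nonextremal_preserved (V : zmodType) (phi psi : V -> V) (T : seq V) :
  cancel phi psi -> cancel psi phi -> preserves_steps phi T ->
  preserves_steps phi [seq t <- T | ~~ extremal T t].
Proof.
move=> phiK psiK pres x y.
by rewrite !mem_filter pres (extremal_preserved phiK psiK pres).
Qed.

(** Each point of the line is the only midpoint of its two neighbours, and [phi]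
    keeps it so; hence consecutive steps of the image are equal. *)
Lemma extremal_line (V : zmodType) (phi psi : V -> V) (T : seq V) (x t : V)
    (k : nat) :
  cancel phi psi -> cancel psi phi -> preserves_steps phi T -> extremal T t ->
  phi (x + t *+ k) = phi x + (phi (x + t) - phi x) *+ k.
Proof.
move=> phiK psiK pres ext.
have step y : phi (y + t + t) - phi (y + t) = phi (y + t) - phi y.
  apply: (@unique_midpoint_straight _ T).
  apply: (unique_midpoint_preserved phiK psiK pres).
  exact: extremal_unique_midpoint.
have steps i : phi (x + t *+ i + t) - phi (x + t *+ i) = phi (x + t) - phi x.
  elim: i => [|i IH]; first by rewrite mulr0n addr0.
  by rewrite mulrSr addrA step.
elim: k => [|k IH]; first by rewrite !mulr0n !addr0.
by rewrite !mulrSr addrA [RHS]addrA -IH -(steps k) [RHS]addrC subrK.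
Qed.

(** * Parallel lines *)

Definition torsion_free (V : zmodType) : Prop :=
  forall (v : V) (k : nat), v *+ k = 0 -> k = 0 \/ v = 0.

Lemma torsion_free_rV (n : nat) : torsion_free 'rV[int]_n.
Proof.
move=> v [|k] vk0; [by left | right; apply/rowP => i].
have := congr1 (fun w : 'rV_n => w 0 i) vk0.
by rewrite mulmxnE !mxE => /eqP; rewrite mulrn_eq0 => /eqP.
Qed.

(** By the pigeonhole principle: in a torsion-free group the points of a
    nonconstant arithmetic progression are distinct. *)
Lemma bounded_progression (V : zmodType) (T : seq V) (a d : V) :
  torsion_free V -> (forall k, a + d *+ k \in T) -> d = 0.
Proof.
move=> tf inT; apply/eqP; apply: contraT => d0.
have inj : injective (fun k => a + d *+ k).
  move=> i j /addrI; wlog le_ij : i j / (i <= j)%N => [wl|] eij.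
    by case/orP: (leq_total i j) => le; [|symmetry]; apply: wl.
  have [|/eqP e|e] := tf d (j - i)%N; last by rewrite e eqxx in d0.
    by rewrite mulrnBr // eij subrr.
  by apply/eqP; rewrite eqn_leq le_ij -subn_eq0.
have := @uniq_leq_size _ [seq a + d *+ k | k <- iota 0 (size T).+1] T.
rewrite map_inj_uniq // iota_uniq size_map size_iota ltnn; apply=> //.
by move=> _ /mapP[k _ ->].
Qed.

(** The image lines drift apart linearly in the difference of their directions,
    while corresponding points of them stay one [S]-step apart.  The direction
    comes from [T] but the comparison from [S]: Cay(T) may be disconnected, and
    then relates no two lines in different components. *)
Lemma extremal_parallel (V : zmodType) (phi psi : V -> V) (S T : seq V)
    (x s t : V) :
  torsion_free V -> cancel phi psi -> cancel psi phi ->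
  preserves_steps phi S -> preserves_steps phi T ->
  s \in S -> extremal T t ->
  phi (x + s + t) - phi (x + s) = phi (x + t) - phi x.
Proof.
move=> tf phiK psiK presS presT sS ext; apply/eqP; rewrite -subr_eq0; apply/eqP.
apply: (@bounded_progression _ S (phi (x + s) - phi x)) => // k.
have -> : phi (x + s) - phi x
    + (phi (x + s + t) - phi (x + s) - (phi (x + t) - phi x)) *+ k
    = phi (x + s + t *+ k) - phi (x + t *+ k).
  rewrite !(extremal_line _ _ phiK psiK presT ext) mulrnBl [in RHS]opprD.
  by rewrite addrACA.
by rewrite presS [x + s + _]addrAC [_ + s]addrC addrK.
Qed.

Lemma generates_ind (V : zmodType) (S H : set V) :
  generates S -> zmod_closed [in H] -> S `<=` H -> forall v, H v.
Proof.
move=> gen closedH subH v; have : setT v by [].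
by rewrite -gen; apply.
Qed.

(** * Automorphisms are affine *)

(** Equivalently, conjugating the translation by [t] by [phi] yields a
    translation. *)
Definition rigid (V : zmodType) (phi : V -> V) (t : V) : Prop :=
  forall x, phi (x + t) - phi x = phi t - phi 0.

Lemma rigid_zmod_closed (V : zmodType) (phi : V -> V) :
  zmod_closed [in [set t | rigid phi t]].
Proof.
split=> [|a b]; first by rewrite inE /= => x; rewrite addr0 !subrr.
rewrite !inE /= => ra rb x.
have shift y : phi (y - b) - phi y = phi 0 - phi b.
  by rewrite -(opprB (phi b)) -(rb (y - b)) subrK opprB.
rewrite addrA -[LHS](subrKA (phi (x + a))) shift ra.
by rewrite addrC -[RHS](subrKA (phi a)) shift addrC.
Qed.

Lemma extremal_rigid (V : zmodType) (phi psi : V -> V) (S T : seq V) (t : V) :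
  torsion_free V -> cancel phi psi -> cancel psi phi ->
  generates [set` S] -> preserves_steps phi S -> preserves_steps phi T ->
  extremal T t -> rigid phi t.
Proof.
move=> tf phiK psiK gen presS presT ext x.
pose H := [set c | forall y,
  phi (y + c + t) - phi (y + c) = phi (y + t) - phi y].
have Hx : H x.
  apply: (generates_ind (H := H) gen) => [|s /= sS y]; last first.
    exact: (extremal_parallel _ tf phiK psiK presS presT).
  split=> [|a b]; first by rewrite inE /= => y; rewrite addr0.
  by rewrite !inE /= => Ha Hb y; rewrite -Hb addrA subrK Ha.
by have := Hx 0; rewrite !add0r.
Qed.

(** Peel off the extremal elements, which form an invariant class of steps, and
    recurse on the remaining ones. *)
Lemma preserved_rigid (n : nat) (phi psi : 'rV[int]_n -> 'rV[int]_n)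
    (S T : seq 'rV[int]_n) :
  cancel phi psi -> cancel psi phi ->
  generates [set` S] -> preserves_steps phi S -> preserves_steps phi T ->
  {in T, forall t, rigid phi t}.
Proof.
move=> phiK psiK gen presS.
have [m] := ubnP (size T); elim: m T => // m IH T ltTm presT t tT.
have [ext|nonext] := boolP (extremal T t).
  apply: (extremal_rigid _ phiK psiK gen presS presT ext).
  exact: torsion_free_rV.
apply: (IH [seq u <- T | ~~ extremal T u]); last by rewrite mem_filter nonext.
  rewrite -ltnS; apply: leq_trans ltTm; rewrite ltnS size_filter.
  have T0 : T != [::] by case: T tT {presT nonext}.
  rewrite -(count_predC (extremal T)) -add1n leq_add2r -has_count.
  exact: exists_extremal.
exact: (nonextremal_preserved phiK psiK).
Qed.

Lemma Aut_Cay_rigid (n : nat) (S : set 'rV[int]_n) (g : Aut (Cay S)) c :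
  finite_set S -> generates S -> rigid (g : 'rV[int]_n -> 'rV[int]_n) c.
Proof.
case/finite_seqP=> s eS gen.
have arcE x y : @Defs.arc (Cay S) x y <-> y - x \in s.
  split=> [[u + ->]|yx]; first by rewrite eS /= addrAC subrr add0r.
  by exists (y - x); rewrite ?eS //= addrC subrK.
have pres : preserves_steps g s.
  by move=> x y; apply/idP/idP => /arcE/(aut_arc g)/arcE.
have gen' : generates [set` s] by rewrite -eS.
apply: (generates_ind gen (H := [set t | rigid _ t])) => [|t].
  exact: rigid_zmod_closed.
rewrite {1}eS /=.
exact: (preserved_rigid (@aut_funK _ g) (@aut_invK _ g) gen').
Qed.

Theorem corollary5p5 (n : nat) (S : set 'rV[int]_n)
  (S_finite : finite_set S) (S_nonzero : ~ S 0) (S_generates : generates S) :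
  [/\ {morph translation S : c d / c + d >-> (c * d)%g},
      injective (translation S)
    & normal_subgroup (translations S)].
Proof.
have transD : {morph translation S : c d / c + d >-> (c * d)%g}.
  by move=> c d; apply: aut_ext => x /=; rewrite [c + d]addrC addrA.
have transN c : translation S (- c) = (translation S c)^-1%g.
  by apply: aut_ext.
split=> //.
  move=> c d ecd; have /= := congr1 (fun g : Aut (Cay S) => g (0 : 'rV_n)) ecd.
  by rewrite !add0r.
split.
  split=> [|g1 g2].
    by rewrite inE /=; exists 0 => //; apply: aut_ext => x /=; rewrite addr0.
  rewrite !inE => -[c _ <-] [d _ <-].
  by exists (c - d); rewrite // transD transN.
(* The conjugate [g ^ h] is [h^-1 * g * h], so it is the affinity of [h^-1]
   that is used. *)
move=> _ h [c _ <-]; pose phi := aut_V h.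
exists (phi c - phi 0) => //; apply: aut_ext => x /=.
have := Aut_Cay_rigid phi c S_finite S_generates (h x).
by rewrite /phi /= aut_funK => <-; rewrite addrC subrK.
Qed.
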